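(* Let $n\in\mathbb N$ and let $\gamma \in C^{0,1}(\mathbb R/\mathbb Z,\mathbb R^n)$ be a curve parametrized by arc-length (i.e. $|\gamma'|=1$ almost everywhere) with $\gamma' \in VMO(\mathbb R/\mathbb Z,\mathbb R^n)$. For $\varepsilon>0$ let $\gamma_\varepsilon=\gamma*\eta_\varepsilon$. Then $|\gamma_\varepsilon'|$ converges uniformly on $\mathbb R/\mathbb Z$ to $|\gamma'|=1$ as $\varepsilon\to 0$. In particular, the curves $\gamma_\varepsilon$ are regular if $\varepsilon$ is small enough, i.e. there is $\varepsilon_0>0$ such that $\gamma_\varepsilon'(x)\neq 0$ for all $x\in\mathbb R/\mathbb Z$ and all $0<\varepsilon<\varepsilon_0$.
   Context: VMO: an integrable function $f:\mathbb R/\mathbb Z\to\mathbb R^n$ belongs to $VMO(\mathbb R/\mathbb Z,\mathbb R^n)$ (vanishing mean oscillation) if $$\lim_{r\to 0}\ \sup_{x\in\mathbb R/\mathbb Z}\ \frac1{2r}\int_{B_r(x)}\bigl|f(y)-\overline f_{B_r(x)}\bigr|\,dy=0,$$ where $B_r(x)$ is the ball (interval) of radius $r$ around $x$ and $\overline f_{B_r(x)}$ is the integral mean of $f$ over $B_r(x)$. Mollifier: $\eta\in C^\infty(\mathbb R,[0,\infty))$ is a fixed function with $\eta\equiv 0$ on $\mathbb R\setminus(-1,1)$ and $\int_{\mathbb R}\eta\,dx=1$, and $\eta_\varepsilon(x)=\frac1\varepsilon\eta\left(\frac x\varepsilon\right)$. The convolution is $\gamma_\varepsilon(x)=\int_{\mathbb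 R}\gamma(x-y)\eta_\varepsilon(y)\,dy$, where $\gamma$ is regarded as a $1$-periodic function on $\mathbb R$. *)

(* Defs.v *)
From HB Require Import structures.
From mathcomp Require Import all_boot all_order all_algebra.
From mathcomp Require Import all_classical all_reals all_analysis.

Set Implicit Arguments.
Unset Strict Implicit.
Unset Printing Implicit Defensive.

Import Order.TTheory GRing.Theory Num.Theory.
Import numFieldNormedType.Exports.

Local Open Scope classical_set_scope.
Local Open Scope ring_scope.

(* Functions on R/Z are represented by their 1-periodic lifts to R.           *)

(* The canonical norm `|v| of 'rV[R]_n is the max norm, hence this definition *)
(* of the Euclidean length.                                                   *)
Definition eucl_norm {R : realType} {n : nat} (v : 'rV[R]_n) : R :=
  Num.sqrt (\sum_(i < n) v ord0 i ^+ 2).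

(* [lipschitz] refers to the max norm on 'rV[R]_n; by equivalence of norms    *)
(* this is the same condition as for the Euclidean norm. A periodic lift is   *)
(* Lipschitz on R iff the function is Lipschitz on R/Z.                       *)
Definition lipschitz_curve {R : realType} {n : nat} (g : R -> 'rV[R]_n) :=
  periodic g 1 /\ lipschitz (g : R^o -> 'rV[R]_n).

(* derive1 g is total, with a default value where g has no derivative, hence  *)
(* the explicit derivability.                                                 *)
Definition arclength_parametrized {R : realType} {n : nat}
    (g : R -> 'rV[R]_n) :=
  {ae lebesgue_measure,
    forall x : R, derivable g x 1 /\ eucl_norm (derive1 g x) = 1}.

Definition ball_mean {R : realType} {n : nat} (f : R -> 'rV[R]_n)
    (x r : R) : 'rV[R]_n :=
  \row_(i < n) ((2 * r)^-1 *
                \int[lebesgue_measure]_(y in ball x r) f y ord0 i).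

Definition mean_oscillation {R : realType} {n : nat} (f : R -> 'rV[R]_n)
    (x r : R) : \bar R :=
  (((2 * r)^-1)%:E *
   \int[lebesgue_measure]_(y in ball x r)
      (eucl_norm (f y - ball_mean f x r))%:E)%E.

Definition VMO {R : realType} {n : nat} (f : R -> 'rV[R]_n) :=
  [/\ periodic f 1,
      forall i : 'I_n, lebesgue_measure.-integrable `[0%R, 1%R]
                         (fun x => (f x ord0 i)%:E) &
      ereal_sup (range (fun x : R => mean_oscillation f x r)) @[r --> 0^'+]
        --> 0%E].

Definition smooth {R : realType} (f : R -> R) :=
  forall (k : nat) (x : R), derivable (derive1n k f) x 1.

Definition mollifier {R : realType} (eta : R -> R) :=
  [/\ smooth eta,
      forall x, 0 <= eta x,
      forall x, x \notin `]-1, 1[ -> eta x = 0 &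
      (\int[lebesgue_measure]_x (eta x)%:E = 1)%E].

Definition mollifier_scale {R : realType} (eta : R -> R) (eps : R) : R -> R :=
  fun x => eps^-1 * eta (x / eps).

Definition convolution {R : realType} {n : nat} (g : R -> 'rV[R]_n)
    (phi : R -> R) : R -> 'rV[R]_n :=
  fun x => \row_(i < n)
    \int[lebesgue_measure]_y (g (x - y) ord0 i * phi y).

Definition mollify {R : realType} {n : nat} (eta : R -> R)
    (g : R -> 'rV[R]_n) (eps : R) : R -> 'rV[R]_n :=
  convolution g (mollifier_scale eta eps).

Definition regular_curve {R : realType} {n : nat} (g : R -> 'rV[R]_n) :=
  forall x : R, derivable g x 1 /\ derive1 g x != 0.

(* Main.v *)
(* Let f = gamma' and let m be the mean of f over B_eps(x). As |f| = 1 almost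
   everywhere, | |m| - 1 | is at most the mean oscillation of f on B_eps(x);
   as eta_eps is supported in B_eps(0) and bounded by C / eps, the i-th
   component of f * eta_eps - m at x is at most 2 C times this oscillation.
   Both bounds vanish uniformly in x since f is VMO. Finally
   (gamma * eta_eps)' = f * eta_eps by dominated convergence: the difference
   quotients of the Lipschitz function gamma are bounded and converge almost
   everywhere, so that no absolute continuity argument is needed. *)
Require Import Defs.
From HB Require Import structures.
From mathcomp Require Import all_boot all_order all_algebra.
From mathcomp Require Import all_classical all_reals all_analysis.
From mathcomp Require Import measurable_realfun ring lra.
Import Order.TTheory GRing.Theory Num.Theory.
Import numFieldNormedType.Exports.
Local Open Scope classical_set_scope.
Local Open Scope ring_scope.

(** * Affine changes of variables for Lebesgue measure *)

Lemma measurable_affine (R : realType) (a b : R) :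
  measurable_fun [set: measurableTypeR R]
    (fun y => a * y + b : measurableTypeR R).
Proof.
by apply: measurable_funD; [exact: mulrl_measurable|exact: measurable_cst].
Qed.

(** Lebesgue measure is determined by its values on the intervals []c, d]], so it is enough that
    [|a|] times the pushforward under [y |-> a * y + b] has the same values there. *)
Lemma lebesgue_measure_affine (R : realType) (a b : R) (A : set R) :
  a != 0 -> measurable A ->
  lebesgue_measure ((fun y : R => a * y + b) @^-1` A) =
    (`|a|^-1%:E * lebesgue_measure A)%E.
Proof.
move=> a0 mA.
have an0 : 0 < `|a| by rewrite normr_gt0.
pose phi (y : measurableTypeR R) : measurableTypeR R := a * y + b.
have mphi : measurable_fun setT phi by exact: measurable_affine.
pose nu : {measure set (measurableTypeR R) -> \bar R} :=
  mscale (NngNum (ltW an0)) (pushforward lebesgue_measure phi).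
suff -> : lebesgue_measure A = nu mphi A.
  by rewrite /nu /mscale /= muleA -EFinM mulVf ?gt_eqF// mul1e.
apply: lebesgue_measure_unique => //= _ [[c d]] _ <-.
rewrite /nu /mscale /= /pushforward.
(* A negative slope swaps the endpoints, so the preimage of []c, d]] is closed on the left and open
   on the right. *)
have [lt0|gt0] := ltrP a 0.
  have -> : phi @^-1` `]c, d] = [set` `[(d - b) / a, (c - b) / a[].
    apply/seteqP; split=> y /=; rewrite /phi !in_itv/=;
    by rewrite ltr_ndivlMr// ler_ndivrMr// ltrBlDr lerBrDr mulrC andbC.
  rewrite !lebesgue_measure_itv/= !lte_fin.
  rewrite ltr_ndivrMr// divfK ?lt_eqF// ltrD2r.
  case: ifP => _; last by rewrite mule0.
  rewrite -!EFinD -EFinM ltr0_norm//; congr EFin; field.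
  by rewrite lt_eqF.
have {}gt0 : 0 < a by rewrite lt_neqAle eq_sym a0.
have -> : phi @^-1` `]c, d] = [set` `](c - b) / a, (d - b) / a]].
  apply/seteqP; split=> y /=; rewrite /phi !in_itv/=;
  by rewrite ltr_pdivrMr// ler_pdivlMr// ltrBlDr lerBrDr mulrC.
rewrite !lebesgue_measure_itv/= !lte_fin.
rewrite ltr_pdivrMr// divfK ?gt_eqF// ltrD2r.
case: ifP => _; last by rewrite mule0.
rewrite -!EFinD -EFinM gtr0_norm//; congr EFin; field.
by rewrite gt_eqF.
Qed.

Lemma ge0_integral_affine (R : realType) (a b : R) (D : set R)
    (f : R -> \bar R) :
  a != 0 -> measurable D -> measurable_fun D f ->
  {in D, forall y, (0 <= f y)%E} ->
  (\int[lebesgue_measure]_(y in (fun y => a * y + b)%R @^-1` D)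
     f (a * y + b)%R =
   `|a|^-1%:E * \int[lebesgue_measure]_(y in D) f y)%E.
Proof.
move=> a0 mD mf f0.
have nn : 0 <= `|a|^-1 by rewrite invr_ge0.
have -> := esym (@ge0_integral_mscale _ (measurableTypeR R) R
  lebesgue_measure D mD (NngNum nn) f mf _); last first.
  by move=> x Dx; apply: f0; rewrite inE.
rewrite -[LHS](@ge0_integral_pushforward _ _ _ _ _ _
  (measurable_affine R a b) lebesgue_measure D f)//.
apply: eq_measure_integral => [|mphi A mA AD]; first exact: measurable_affine.
exact: lebesgue_measure_affine.
Qed.

(** Used with [a = -1] to carry almost everywhere differentiability from [y] to [x - y], the
    argument inside a convolution. *)
Lemma ae_affine (R : realType) (a b : R) (P : R -> Prop) : a != 0 ->
  {ae lebesgue_measure, forall y, P y} ->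
  {ae lebesgue_measure, forall y, P (a * y + b)}.
Proof.
move=> a0 [N [mN N0 PN]]; exists ((fun y => a * y + b) @^-1` N); split.
- by rewrite -[X in measurable X]setTI; exact: measurable_affine.
- by rewrite lebesgue_measure_affine// N0 mule0.
- by move=> y /= nPy; exact: PN.
Qed.

Lemma ae_impl (R : realType) (P Q : R -> Prop) : (forall y, P y -> Q y) ->
  {ae lebesgue_measure, forall y, P y} -> {ae lebesgue_measure, forall y, Q y}.
Proof.
move=> PQ; apply: filterS => //.
exact: (ae_filter_ringOfSetsType lebesgue_measure).
Qed.

(** * Differentiation of a convolution with a Lipschitz function *)

Lemma lipschitz_continuous (R : realType) (g : R -> R) (L : R) :
  (forall a b, `|g a - g b| <= L * `|a - b|) -> continuous g.
Proof.
move=> gL x; apply/cvgrPdist_le => e e0.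
have L0 : 0 <= L by have := gL 1 0; rewrite subr0 normr1 mulr1; apply: le_trans.
have L1 : 0 < L + 1 by rewrite ltr_wpDl.
near=> t; rewrite (le_trans (gL _ _))//.
have : `|x - t| <= e / (L + 1).
  near: t; apply/nbhs_ballP; exists (e / (L + 1)); first exact: divr_gt0.
  by move=> t /= /ltW.
rewrite ler_pdivlMr// => /(le_trans _); apply.
by rewrite mulrC ler_wpM2l// lerDl.
Unshelve. all: by end_near. Qed.

Section convolution_derivative.
Context {R : realType}.
Variables (g f phi : R -> R) (L r : R).
Hypotheses (gL : forall a b, `|g a - g b| <= L * `|a - b|)
  (mf : measurable_fun setT f)
  (dg : {ae lebesgue_measure, forall y : R, is_derive y 1 g (f y)})
  (phi0 : forall y, 0 <= phi y)
  (iphi : lebesgue_measure.-integrable setT (EFin \o phi))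
  (phir : forall y, r <= `|y| -> phi y = 0).

Let mphi : measurable_fun setT phi.
Proof. by apply/measurable_EFinP; exact: measurable_int iphi. Qed.

Let measurable_reflect (h : R -> R) (x : R) : measurable_fun setT h ->
  measurable_fun [set: R] (fun y : R => h (x - y)).
Proof.
move=> mh; apply: measurableT_comp => //.
by apply: measurable_funB => //; exact: measurable_id.
Qed.

(** Where [phi] does not vanish, [y] has absolute value below [r], so [g (x - y)] differs from [g x]
    by at most [L * |r|]; the integrand is dominated by a multiple of [phi]. *)
Lemma integrable_lipschitz_convolution (x : R) :
  lebesgue_measure.-integrable [set: R] (fun y : R => (g (x - y) * phi y)%:E).
Proof.
have L0 : 0 <= L by have := gL 1 0; rewrite subr0 normr1 mulr1; apply: le_trans.
have mg : measurable_fun setT g.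
  by apply: continuous_measurable_fun; exact: lipschitz_continuous gL.
apply: (le_integrable _ _ _ (integrableZl _ (`|g x| + L * `|r|) iphi)) => //.
  by apply/measurable_EFinP/measurable_funM => //; exact: measurable_reflect.
move=> y _ /=; rewrite lee_fin !normrM (ger0_norm (phi0 y)).
have [/phir ->|yr] := leP r `|y|; first by rewrite !mulr0.
rewrite ler_wpM2r// [leRHS]ger0_norm ?addr_ge0 ?mulr_ge0//.
rewrite -[g (x - y)](subrKC (g x)) (le_trans (ler_normD _ _))// lerD2l.
rewrite (le_trans (gL _ _))// ler_wpM2l// addrAC subrr add0r normrN.
by rewrite (le_trans (ltW yr))// ler_norm.
Qed.

(** Dominated convergence concerns sequences, so the limit of the difference quotients [q h] is
    taken along an arbitrary sequence of nonzero [u n] tending to 0, with dominating function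
    [L * phi]. The integrability of the limit comes out of the same application. *)
Lemma convolution_derivative (x : R) :
  lebesgue_measure.-integrable [set: R] (fun y : R => (f (x - y) * phi y)%:E) /\
  is_derive x 1 (fun x => \int[lebesgue_measure]_y (g (x - y) * phi y))
    (\int[lebesgue_measure]_y (f (x - y) * phi y)).
Proof.
pose q (h : R) (y : R) := h^-1 * (g (h + x - y) - g (x - y)) * phi y.
have mg : measurable_fun setT g.
  by apply: continuous_measurable_fun; exact: lipschitz_continuous gL.
have mq h : measurable_fun setT (q h).
  apply: measurable_funM => //; apply: measurable_funM => //.
  by apply: measurable_funB; exact: measurable_reflect.
have mfx : measurable_fun [set: R] (fun y : R => f (x - y) * phi y).
  by apply: measurable_funM => //; exact: measurable_reflect.
have dgx : {ae lebesgue_measure, forall y : R,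
    is_derive (x - y) 1 g (f (x - y))}.
  have N1 : (-1 : R) != 0 by rewrite oppr_eq0 oner_neq0.
  apply: ae_impl (ae_affine R _ x _ N1 dg) => y.
  by rewrite mulN1r addrC.
have DC (u : R^nat) : (forall n, u n != 0) /\ u n @[n --> \oo] --> 0 ->
  lebesgue_measure.-integrable [set: R] (fun y : R => (f (x - y) * phi y)%:E) /\
  \int[lebesgue_measure]_y q (u n) y @[n --> \oo] -->
  \int[lebesgue_measure]_y (f (x - y) * phi y).
  move=> u0.
  have qcvg : {ae lebesgue_measure, forall y : R, setT y ->
     (q (u n) y)%:E @[n --> \oo] --> (f (x - y) * phi y)%:E}.
    apply: ae_impl dgx => y [dgy <-] _.
    apply: cvg_EFin; first exact: nearW.
    rewrite /q; apply: cvgMr_tmp.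
    have := (cvgr_dnbhsP _ _ _).1 dgy u u0.
    rewrite /derive; under eq_fun => n do rewrite /= scaler1 addrA.
    exact.
  have qdom : {ae lebesgue_measure, forall (y : R) n, setT y ->
     (`|(q (u n) y)%:E| <= (L * phi y)%:E)%E}.
    apply: aeW => y n _; rewrite lee_fin /q normrM (ger0_norm (phi0 y)).
    rewrite ler_wpM2r// normrM normfV.
    rewrite ler_pdivrMl ?normr_gt0; last exact: u0.1.
    by rewrite mulrC (le_trans (gL _ _))// opprB addrA subrK addrK.
  have iL : lebesgue_measure.-integrable [set: R] (fun y : R => (L * phi y)%:E).
    by under eq_fun do rewrite EFinM; exact: integrableZl.
  have [] := @dominated_convergence _ _ R lebesgue_measure setT measurableT
    (fun n y => (q (u n) y)%:E) _ _
    (fun n => (measurable_EFinP _ _).2 (mq (u n)))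
    ((measurable_EFinP _ _).2 mfx) qcvg iL qdom.
  move=> ifx _ cvgint; split => //.
  move: cvgint; rewrite -(fineK (integrable_fin_num measurableT ifx)).
  exact: fine_cvg.
(* One concrete admissible sequence, to extract the integrability, which does not mention [u]. *)
have harm : (forall n, (n.+1%:R^-1 : R) != 0) /\
    n.+1%:R^-1 @[n --> \oo] --> (0 : R).
  by split=> [n|]; [rewrite invr_eq0 pnatr_eq0|exact: cvg_harmonic].
split; first exact: (DC _ harm).1.
pose F x := \int[lebesgue_measure]_y (g (x - y) * phi y).
have qF h : \int[lebesgue_measure]_y q h y = h^-1 * (F (h + x) - F x).
  rewrite -RintegralB//; try exact: integrable_lipschitz_convolution.
  rewrite -RintegralZl//; last first.
    rewrite /comp; under eq_fun do rewrite EFinB.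
    by apply: integrableB => //; exact: integrable_lipschitz_convolution.
  by apply: eq_Rintegral => y _; rewrite /q -mulrA mulrBl.
have cvgF : h^-1 *: (F (h *: 1 + x) - F x) @[h --> 0^'] -->
    \int[lebesgue_measure]_y (f (x - y) * phi y).
  apply/cvgr_dnbhsP => u u0.
  under eq_fun => n do rewrite scaler1 -[_ *: _]/(_ * _) -qF.
  exact: (DC u u0).2.
by apply: DeriveDef; [apply/cvg_ex; eexists; exact: cvgF|exact/cvg_lim].
Qed.
End convolution_derivative.

(** * The Euclidean norm on row vectors *)

Section euclidean_norm.
Context {R : realType} {n : nat}.
Implicit Types u v : 'rV[R]_n.

Lemma eucl_norm_ge0 u : 0 <= eucl_norm u.
Proof. exact: sqrtr_ge0. Qed.

Lemma sqr_eucl_norm u : eucl_norm u ^+ 2 = \sum_(i < n) u ord0 i ^+ 2.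
Proof. by rewrite sqr_sqrtr// sumr_ge0// => i _; exact: sqr_ge0. Qed.

Lemma eucl_norm0 : eucl_norm (0 : 'rV[R]_n) = 0.
Proof.
by rewrite /eucl_norm big1 ?sqrtr0// => i _; rewrite mxE expr0n.
Qed.

Lemma eucl_normN u : eucl_norm (- u) = eucl_norm u.
Proof.
by congr Num.sqrt; apply: eq_bigr => i _; rewrite mxE sqrrN.
Qed.

Lemma normr_coord_le_eucl_norm u i : `|u ord0 i| <= eucl_norm u.
Proof.
rewrite -ler_sqr ?nnegrE ?eucl_norm_ge0// sqr_eucl_norm real_normK ?num_real//.
by rewrite (bigD1 i)//= lerDl sumr_ge0// => j _; exact: sqr_ge0.
Qed.

(** Convolutions are estimated one coordinate at a time; this bound reassembles the coordinates and
    causes the factor [n] in the final estimate. *)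
Lemma eucl_norm_le_sum u : eucl_norm u <= \sum_(i < n) `|u ord0 i|.
Proof.
have s0 : 0 <= \sum_(i < n) `|u ord0 i| by exact: sumr_ge0.
rewrite -ler_sqr ?nnegrE ?eucl_norm_ge0// sqr_eucl_norm expr2 mulr_suml.
apply: ler_sum => i _; rewrite -[leLHS]ger0_norm ?sqr_ge0// normrX expr2.
by rewrite ler_wpM2l// (bigD1 i)//= lerDl sumr_ge0.
Qed.

(** With [a] and [b] the norms of [u] and [v], the sum of the squares of the coordinates of
    [b u - a v] equals [2 a b (a b - <u, v>)]. Dividing by [a b] requires it to be positive, so a
    vanishing norm is treated first. *)
Lemma eucl_norm_CauchySchwarz u v :
  \sum_(i < n) u ord0 i * v ord0 i <= eucl_norm u * eucl_norm v.
Proof.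
set a := eucl_norm u; set b := eucl_norm v.
have := eucl_norm_ge0 u; rewrite -/a le_eqVlt => /predU1P[a0|a0].
  rewrite -a0 mul0r big1// => i _; have := normr_coord_le_eucl_norm u i.
  by rewrite -/a -a0 normr_le0 => /eqP ->; rewrite mul0r.
have := eucl_norm_ge0 v; rewrite -/b le_eqVlt => /predU1P[b0|b0].
  rewrite -b0 mulr0 big1// => i _; have := normr_coord_le_eucl_norm v i.
  by rewrite -/b -b0 normr_le0 => /eqP ->; rewrite mulr0.
have : 0 <= \sum_(i < n) (b * u ord0 i - a * v ord0 i) ^+ 2.
  by apply: sumr_ge0 => i _; exact: sqr_ge0.
have -> : \sum_(i < n) (b * u ord0 i - a * v ord0 i) ^+ 2 =
    (a * b) * (a * b - \sum_(i < n) u ord0 i * v ord0 i) *+ 2.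
  transitivity (b ^+ 2 * \sum_(i < n) u ord0 i ^+ 2 +
      a ^+ 2 * \sum_(i < n) v ord0 i ^+ 2 -
      2 * a * b * \sum_(i < n) u ord0 i * v ord0 i).
    by rewrite !mulr_sumr -big_split -sumrB; apply: eq_bigr => i _ /=; ring.
  by rewrite -!sqr_eucl_norm -/a -/b; ring.
by rewrite pmulrn_lge0// pmulr_rge0 ?mulr_gt0// subr_ge0.
Qed.

Lemma ler_eucl_normD u v : eucl_norm (u + v) <= eucl_norm u + eucl_norm v.
Proof.
rewrite -ler_sqr ?nnegrE ?addr_ge0 ?eucl_norm_ge0// sqr_eucl_norm sqrrD.
rewrite !sqr_eucl_norm.
have -> : \sum_(i < n) (u + v) ord0 i ^+ 2 = \sum_(i < n) u ord0 i ^+ 2 +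
    (\sum_(i < n) u ord0 i * v ord0 i) *+ 2 + \sum_(i < n) v ord0 i ^+ 2.
  by rewrite -sumrMnl -!big_split; apply: eq_bigr => i _ /=; rewrite mxE sqrrD.
by rewrite lerD2r lerD2l ler_pMn2r// eucl_norm_CauchySchwarz.
Qed.

Lemma ler_dist_eucl_norm u v :
  `|eucl_norm u - eucl_norm v| <= eucl_norm (u - v).
Proof.
have H (w z : 'rV[R]_n) : eucl_norm w - eucl_norm z <= eucl_norm (w - z).
  by rewrite lerBlDr -[in leLHS](subrK z w) ler_eucl_normD.
by rewrite ler_norml H andbT lerNl opprB (le_trans (H _ _))// -eucl_normN opprB.
Qed.

Lemma measurable_eucl_norm (f : R -> 'rV[R]_n) (D : set R) :
  (forall i, measurable_fun D (fun y : R => f y ord0 i)) ->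
  measurable_fun D (fun y : R => eucl_norm (f y)).
Proof.
move=> mf; apply: (@measurableT_comp _ _ _ _ _ _ (@Num.sqrt R)).
  exact: continuous_measurable_fun (@sqrt_continuous R).
by apply: measurable_sum => i; exact: measurable_funX.
Qed.

End euclidean_norm.

(** * Consequences of small mean oscillation on one ball *)

Section ball_estimates.
Context {R : realType} {n : nat}.
Variables (f : R -> 'rV[R]_n) (m : 'rV[R]_n) (x r d : R).
Hypotheses (r0 : 0 < r)
  (mf : forall i, measurable_fun setT (fun y : R => f y ord0 i))
  (fm : (\int[lebesgue_measure]_(y in ball x r) (eucl_norm (f y - m))%:E <=
         (2 * r * d)%:E)%E).

Let mD : measurable_fun setT (fun y : R => eucl_norm (f y - m)).
Proof.
apply: measurable_eucl_norm => i; under eq_fun do rewrite !mxE.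
by apply: measurable_funB => //; exact: mf.
Qed.

(** Where [f y] has norm 1, the reverse triangle inequality bounds the constant [| |m| - 1 |] by
    [|f y - m|]. Integrating over the ball, of measure [2 * r], and dividing gives the claim. *)
Lemma unit_eucl_norm_close :
  {ae lebesgue_measure, forall y : R, eucl_norm (f y) = 1} ->
  `|eucl_norm m - 1| <= d.
Proof.
move=> f1.
have : (\int[lebesgue_measure]_(y in ball x r) (`|eucl_norm m - 1|)%:E <=
    (2 * r * d)%:E)%E.
  apply: le_trans fm; apply: ae_ge0_le_integral.
  - exact: measurable_ball.
  - by move=> y _; rewrite lee_fin.
  - exact: measurable_cst.
  - by move=> y _; rewrite lee_fin eucl_norm_ge0.
  - by apply/measurable_EFinP; exact: measurable_funTS mD.
  - apply: ae_impl f1 => y fy _; rewrite lee_fin.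
    by rewrite -[leRHS]eucl_normN opprB -fy ler_dist_eucl_norm.
rewrite integral_cst//=; last exact: measurable_ball.
rewrite lebesgue_measure_ball ?(ltW r0)//.
rewrite -EFinM lee_fin -(mulr_natl r) [leLHS]mulrC. rewrite ler_pM2l//.
exact: mulr_gt0.
Qed.

(** As [phi] has mass 1, [m ord0 i] is itself the integral of [m ord0 i * phi]. The difference is
    thus at most [C / r] times the integral of [|f - m|] over [ball x r], that is
    [C / r * (2 * r * d)]. *)
Lemma convolution_close (phi : R -> R) (C : R) (i : 'I_n) :
  measurable_fun setT phi ->
  (forall y, 0 <= phi y <= C / r) ->
  (forall y, r <= `|y| -> phi y = 0) ->
  (\int[lebesgue_measure]_y (phi y)%:E = 1)%E ->
  lebesgue_measure.-integrable setT
    (fun y : R => (f (x - y) ord0 i * phi y)%:E) ->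
  `|\int[lebesgue_measure]_y (f (x - y) ord0 i * phi y) - m ord0 i| <=
    2 * C * d.
Proof.
move=> mphi phiC phir phi1 ifphi.
have phi0 y : 0 <= phi y by have /andP[] := phiC y.
have C0 : 0 <= C.
  by have /andP[/le_trans h /h] := phiC 0; rewrite pmulr_lge0 ?invr_gt0.
have iphi : lebesgue_measure.-integrable setT (fun y : R => (phi y)%:E).
  apply/integrableP; split; first exact/measurable_EFinP.
  under eq_integral do rewrite /= ger0_norm//.
  by rewrite phi1 ltry.
have imphi : lebesgue_measure.-integrable setT
    (fun y : R => (m ord0 i * phi y)%:E).
  by under eq_fun do rewrite EFinM; exact: integrableZl.
have -> : m ord0 i = \int[lebesgue_measure]_y (m ord0 i * phi y).
  by rewrite RintegralZl// /Rintegral phi1 mulr1.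
rewrite -RintegralB// -lee_fin EFin_normr_Rintegral//; last first.
  by rewrite /comp; under eq_fun do rewrite EFinB; exact: integrableB.
have N1 : (-1 : R) != 0 by rewrite oppr_eq0 oner_neq0.
(* Written as [-1 * y + x] to fit the affine change of variables, which maps [ball 0 r] onto
   [ball x r]. *)
pose h (y : R) := eucl_norm (f (-1 * y + x) - m).
have mh : measurable_fun setT h.
  by apply: (measurableT_comp mD); exact: measurable_affine.
have balx : ball (0 : R) r = (fun y : R => -1 * y + x) @^-1` ball x r.
  apply/seteqP; split=> y; rewrite /ball/= sub0r normrN mulN1r opprD opprK;
  by rewrite addrCA subrr addr0.
have step : (\int[lebesgue_measure]_(y in ball (0%R : R) r)
    ((C / r)%:E * (h y)%:E) <= (2 * C * d)%:E)%E.
  rewrite ge0_integralZl//.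
  - rewrite balx (ge0_integral_affine R (-1) x (ball x r)
      (fun y : R => (eucl_norm (f y - m))%:E))//.
    + rewrite normrN normr1 invr1 mul1e.
      apply: (@le_trans _ _ ((C / r)%:E * (2 * r * d)%:E)%E).
        by rewrite lee_wpmul2l// lee_fin divr_ge0// ltW.
      rewrite -EFinM lee_fin le_eqVlt; apply/orP; left; apply/eqP; field.
      by rewrite gt_eqF.
    + exact: measurable_ball.
    + by apply/measurable_EFinP; exact: measurable_funTS mD.
    + by move=> y _; rewrite lee_fin eucl_norm_ge0.
  - exact: measurable_ball.
  - by apply/measurable_EFinP; exact: measurable_funTS mh.
  - by move=> y _; rewrite lee_fin eucl_norm_ge0.
  - by rewrite lee_fin divr_ge0// ltW.
apply: le_trans step.
(* Extending the right-hand integrand by zero leaves a pointwise comparison on the whole line;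
   outside the ball [phi] vanishes. *)
rewrite [leRHS]integral_mkcond.
have mfmphi : measurable_fun setT
    (fun y : R => f (x - y) ord0 i * phi y - m ord0 i * phi y).
  apply: measurable_funB; last exact: measurable_funM.
  by apply/measurable_EFinP; exact: measurable_int ifphi.
apply: le_trans (le_abse_integral _ measurableT _) _ => //.
  exact/measurable_EFinP.
apply: ge0_le_integral => //.
- by apply/measurable_EFinP; exact: measurableT_comp.
- apply/(measurable_restrictT _ (measurable_ball _ _)).
  by apply/measurable_EFinP/measurable_funM => //; exact: measurable_funTS mh.
- move=> y _; rewrite patchE /= -mulrBl normrM (ger0_norm (phi0 y)).
  case: ifPn => [yr|yr].
    rewrite -EFinM lee_fin mulrC; have /andP[_ phiCy] := phiC y.
    rewrite ler_pM//.
    rewrite /h mulN1r (addrC (- y)).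
    by have := normr_coord_le_eucl_norm (f (x - y) - m) i; rewrite !mxE.
  rewrite phir ?mulr0// leNgt; apply: contra yr => yr.
  by rewrite inE /ball /= sub0r normrN.
Qed.

End ball_estimates.

(** * Measurability of periodic functions *)

Lemma periodic_floor (R : realType) (V : zmodType) (h : R -> V) (x : R) :
  periodic h 1 -> h (x - (Num.floor x)%:~R) = h x.
Proof.
move=> h1; case: (Num.floor x) => k.
  by rewrite -(periodicn h1 k (x - k%:~R)) pmulrn subrK.
by rewrite NegzE mulrNz opprK -(periodicn h1 k.+1 x) pmulrn.
Qed.

(** [VMO] gives measurability on [[0, 1]] only, while convolutions integrate over the line. A
    periodic [h] is its restriction to [[0, 1]] composed with the fractional part, which is
    measurable because the floor is monotone. *)
Lemma measurable_periodic (R : realType) (h : R -> R) :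
  periodic h 1 -> measurable_fun (`[0, 1] : set R) h -> measurable_fun setT h.
Proof.
move=> h1 mh; pose frac (x : R) := x - (Num.floor x)%:~R.
have mfrac : measurable_fun setT frac.
  apply: measurable_funB; first exact: measurable_id.
  by apply: nondecreasing_measurable => // x y xy; rewrite ler_int le_floor.
have -> : h = (h \_ (`[0, 1] : set R)) \o frac.
  apply/funext => x /=; rewrite patchE mem_set ?periodic_floor//=.
  rewrite in_itv/= subr_ge0 floor_le_tmp /= lerBlDl.
  by rewrite ltW//; have := floorD1_gt x; rewrite intrD.
apply: measurableT_comp => //.
by apply/(measurable_restrictT _ (measurable_itv _)).
Qed.

(** * Bounds, support and mass of the scaled mollifier *)

Section mollifier_theory.
Context {R : realType}.
Variable eta : R -> R.
Hypothesis eta_mollifier : mollifier eta.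

Lemma mollifier_continuous : continuous eta.
Proof.
case: eta_mollifier => seta _ _ _ x.
by apply/differentiable_continuous/derivable1_diffP; exact: (seta 0%N).
Qed.

Lemma mollifier_eq0 y : 1 <= `|y| -> eta y = 0.
Proof.
case: eta_mollifier => _ _ eta0 _ y1; apply: eta0.
by rewrite in_itv/= -ltr_norml -leNgt.
Qed.

(** The maximum over the compact interval [[-1, 1]] serves everywhere: it is nonnegative, and [eta]
    vanishes outside. *)
Lemma mollifier_bounded : exists2 C : R, 0 <= C & forall y, eta y <= C.
Proof.
have [_ eta_ge0 _ _] := eta_mollifier.
have [||c _ cmax] := @EVT_max R eta (-1) 1.
- by rewrite (le_trans (lerN10 _) ler01).
- by apply: continuous_subspaceT => x; exact: mollifier_continuous.
exists (eta c) => // y; have [y1|y1] := leP 1 `|y|.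
  by rewrite mollifier_eq0.
by apply: cmax; rewrite in_itv/= -ler_norml ltW.
Qed.

Variable eps : R.
Hypothesis eps0 : 0 < eps.

Lemma mollifier_scale_ge0 y : 0 <= mollifier_scale eta eps y.
Proof.
have [_ eta_ge0 _ _] := eta_mollifier.
by rewrite mulr_ge0// invr_ge0 ltW.
Qed.

Lemma mollifier_scale_eq0 y : eps <= `|y| -> mollifier_scale eta eps y = 0.
Proof.
move=> epsy; rewrite /mollifier_scale mollifier_eq0 ?mulr0//.
by rewrite normrM normfV (gtr0_norm eps0) ler_pdivlMr// mul1r.
Qed.

Lemma measurable_mollifier_scale :
  measurable_fun setT (mollifier_scale eta eps).
Proof.
apply: measurable_funM => //; apply: measurableT_comp.
  exact: continuous_measurable_fun mollifier_continuous.
exact: mulrr_measurable.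
Qed.

(** The substitution with slope [eps^-1] produces a factor [eps], which cancels the prefactor of
    [mollifier_scale]. *)
Lemma integral_mollifier_scale :
  (\int[lebesgue_measure]_y (mollifier_scale eta eps y)%:E = 1)%E.
Proof.
have [_ eta_ge0 _ eta1] := eta_mollifier.
have e0 : eps^-1 != 0 by rewrite invr_eq0 gt_eqF.
have meta : measurable_fun setT eta.
  exact: continuous_measurable_fun mollifier_continuous.
have -> : (fun y => (mollifier_scale eta eps y)%:E) =
    (fun y => (eps^-1 * eta (eps^-1 * y + 0))%:E).
  by apply/funext => y; rewrite /mollifier_scale addr0 (mulrC y).
rewrite -(preimage_setT (fun y => eps^-1 * y + 0)).
rewrite (ge0_integral_affine R eps^-1 0 setT (fun y => (eps^-1 * eta y)%:E))//.
- under eq_integral do rewrite EFinM.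
  rewrite ge0_integralZl//.
  + rewrite eta1 mule1 -EFinM ger0_norm ?invr_ge0 ?(ltW eps0)//.
    by rewrite invrK divff// gt_eqF.
  + exact/measurable_EFinP.
  + by move=> y _; rewrite lee_fin.
  + by rewrite lee_fin invr_ge0 ltW.
- by apply/measurable_EFinP; exact: measurable_funM.
- by move=> y _; rewrite lee_fin mulr_ge0// invr_ge0 ltW.
Qed.

Lemma integrable_mollifier_scale :
  lebesgue_measure.-integrable setT (EFin \o mollifier_scale eta eps).
Proof.
apply/integrableP; split.
  by apply/measurable_EFinP; exact: measurable_mollifier_scale.
under eq_integral do rewrite /= ger0_norm ?mollifier_scale_ge0//.
by rewrite integral_mollifier_scale ltry.
Qed.

End mollifier_theory.

(** * Coordinatewise and quantitative forms of the hypotheses *)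

Lemma lipschitz_coord (R : realType) (n : nat) (g : R -> 'rV[R]_n) :
  lipschitz (g : R^o -> 'rV[R]_n) ->
  exists L : R, forall i a b, `|g a ord0 i - g b ord0 i| <= L * `|a - b|.
Proof.
(* [lipschitz] holds for all large constants; one positive constant is picked, and the max norm
   makes it valid for every coordinate. *)
move=> /pinfty_ex_gt0[L L0 gL]; exists L => i a b.
apply: le_trans (gL (a, b) _) => //.
rewrite [leRHS]/Num.Def.normr/= mx_normrE.
by apply: le_trans; last exact: (le_bigmax _ _ (ord0, i)); rewrite !mxE.
Qed.

Lemma is_derive_coord (R : realType) (n : nat) (g : R -> 'rV[R]_n) (y : R) i :
  derivable g y 1 -> is_derive y 1 (fun z => g z ord0 i) (derive1 g y ord0 i).
Proof.
move=> dg; apply: DeriveDef; first exact: (derivable_mxP _ _ _).1 dg ord0 i.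
by rewrite derive1E derive_mx// mxE.
Qed.

(** The supremum over centres stands inside the limit, so [r0] does not depend on [x]; the
    uniformity of the convergence originates here. *)
Lemma VMO_mean_oscillation (R : realType) (n : nat) (f : R -> 'rV[R]_n)
    (d : R) :
  VMO f -> 0 < d -> exists2 r0 : R, 0 < r0 &
    forall r x : R, 0 < r -> r < r0 -> (mean_oscillation f x r <= d%:E)%E.
Proof.
move=> [_ _ fVMO] d0.
have /fVMO := @nbhs_open_ereal_lt R 0 (fun=> d) d0.
move=> [r0 /= r00 fr0]; exists r0 => // r x r_gt0 rr0.
apply: (le_trans (ereal_sup_ubound _)); last first.
  by apply: ltW; apply: (fr0 r) => //=; rewrite sub0r normrN gtr0_norm.
by exists x.
Qed.

(** * Speed of the mollified curve *)

Section mollified_curve.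
Context {R : realType} {n : nat}.
Variables (eta : R -> R) (gamma : R -> 'rV[R]_n).
Hypotheses (eta_mollifier : mollifier eta)
  (gamma_lipschitz : lipschitz_curve gamma)
  (gamma_arclength : arclength_parametrized gamma)
  (gamma_VMO : VMO (derive1 gamma)).

Lemma measurable_derive1_coord (i : 'I_n) :
  measurable_fun setT (fun y => derive1 gamma y ord0 i).
Proof.
case: gamma_VMO => per int _.
apply: measurable_periodic => [y|]; first by rewrite per.
by apply/measurable_EFinP; exact: measurable_int (int i).
Qed.

Lemma is_derive_mollify_coord (eps x : R) (i : 'I_n) : 0 < eps ->
  lebesgue_measure.-integrable setT (fun y =>
    (derive1 gamma (x - y) ord0 i * mollifier_scale eta eps y)%:E) /\
  is_derive x 1 (fun x => mollify eta gamma eps x ord0 i)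
    (\int[lebesgue_measure]_y
       (derive1 gamma (x - y) ord0 i * mollifier_scale eta eps y)).
Proof.
move=> eps0; have [L gL] := lipschitz_coord _ _ _ gamma_lipschitz.2.
under [X in is_derive _ _ X _]eq_fun do rewrite mxE.
apply: (convolution_derivative (fun y => gamma y ord0 i)
  (fun y => derive1 gamma y ord0 i) (mollifier_scale eta eps) L eps) => //.
- exact: measurable_derive1_coord.
- apply: ae_impl gamma_arclength => y [dg _]; exact: is_derive_coord.
- by move=> y; exact: mollifier_scale_ge0.
- exact: integrable_mollifier_scale.
- by move=> y; exact: mollifier_scale_eq0.
Qed.

Lemma derivable_mollify (eps x : R) : 0 < eps ->
  derivable (mollify eta gamma eps) x 1.
Proof.
move=> eps0; apply/derivable_mxP => i j; rewrite (ord1 i).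
by have [_ []] := is_derive_mollify_coord eps x j eps0.
Qed.

Lemma derive1_mollify_coord (eps x : R) (i : 'I_n) : 0 < eps ->
  derive1 (mollify eta gamma eps) x ord0 i = \int[lebesgue_measure]_y
    (derive1 gamma (x - y) ord0 i * mollifier_scale eta eps y).
Proof.
move=> eps0; rewrite derive1E derive_mx ?mxE; last exact: derivable_mollify.
by have [_ []] := is_derive_mollify_coord eps x i eps0.
Qed.

(** The triangle inequality through [|m|]: each of the [n] coordinates of the mollified derivative
    minus [m] contributes [2 * C * d], and [| |m| - 1 |] contributes [d]. *)
Lemma eucl_norm_derive1_mollify_close (eps x C d : R) : 0 < eps ->
  (forall y, eta y <= C) ->
  (mean_oscillation (derive1 gamma) x eps <= d%:E)%E ->
  `|eucl_norm (derive1 (mollify eta gamma eps) x) - 1| <=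
    (n%:R * (2 * C) + 1) * d.
Proof.
move=> eps0 etaC osc.
set m := ball_mean (derive1 gamma) x eps.
have {}osc : (\int[lebesgue_measure]_(y in ball x eps)
    (eucl_norm (derive1 gamma y - m))%:E <= (2 * eps * d)%:E)%E.
  by move: osc; rewrite /mean_oscillation lee_pdivrMl ?mulr_gt0.
have f1 : {ae lebesgue_measure, forall y : R, eucl_norm (derive1 gamma y) = 1}.
  by apply: ae_impl gamma_arclength => y [].
rewrite -(subrK (eucl_norm m) (eucl_norm _)) -addrA.
rewrite (le_trans (ler_normD _ _))// mulrDl mul1r lerD//; last first.
  exact: unit_eucl_norm_close measurable_derive1_coord osc f1.
rewrite (le_trans (ler_dist_eucl_norm _ _))// (le_trans (eucl_norm_le_sum _))//.
(* The factor [n%:R] becomes a sum of constants over ['I_n], to be compared term by term. *)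
rewrite -[n in n%:R]card_ord -mulrA mulr_natl -sumr_const ler_sum// => i _.
rewrite mxE derive1_mollify_coord// [in leLHS]mxE.
have [ifphi _] := is_derive_mollify_coord eps x i eps0.
apply: (convolution_close (derive1 gamma) m x eps d eps0
  measurable_derive1_coord osc (mollifier_scale eta eps) C i) => //.
- exact: measurable_mollifier_scale.
- move=> y; rewrite mollifier_scale_ge0//= [leRHS]mulrC.
  by rewrite ler_wpM2l// invr_ge0 ltW.
- by move=> y; exact: mollifier_scale_eq0.
- exact: integral_mollifier_scale.
Qed.

Lemma eucl_norm_derive1_mollify_unif (e : R) : 0 < e ->
  exists2 eps0 : R, 0 < eps0 & forall eps : R, 0 < eps -> eps < eps0 ->
    forall x, `|eucl_norm (derive1 (mollify eta gamma eps) x) - 1| <= e.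
Proof.
move=> e0; have [C C0 etaC] := mollifier_bounded _ eta_mollifier.
(* The summand 1 makes [K] positive, so that oscillation at most [e / K] can be requested. *)
pose K := n%:R * (2 * C) + 1.
have K0 : 0 < K by rewrite ltr_wpDl// !mulr_ge0.
have [r0 r00 osc] := VMO_mean_oscillation _ _ _ _ gamma_VMO (divr_gt0 e0 K0).
exists r0 => // eps eps0 epsr0 x.
apply: le_trans (eucl_norm_derive1_mollify_close _ _ _ _ eps0 etaC
  (osc _ _ eps0 epsr0)) _.
by rewrite mulrC divfK// gt_eqF.
Qed.

End mollified_curve.

Theorem theorem1p1 (R : realType) (n : nat) (eta : R -> R)
    (gamma : R -> 'rV[R]_n)
    (eta_mollifier : mollifier eta)
    (gamma_lipschitz : lipschitz_curve gamma)
    (gamma_arclength : arclength_parametrized gamma)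
    (gamma_VMO : VMO (derive1 gamma)) :
  {uniform, (fun (eps x : R) => eucl_norm (derive1 (mollify eta gamma eps) x))
              @ 0^'+ --> (fun _ : R => 1 : R)}
  /\ exists2 eps0 : R, 0 < eps0 &
       forall eps : R, 0 < eps -> eps < eps0 ->
         regular_curve (mollify eta gamma eps).
Proof.
have unif := eucl_norm_derive1_mollify_unif eta gamma eta_mollifier
  gamma_lipschitz gamma_arclength gamma_VMO.
split.
  move=> P /uniform_nbhs[E [+ EP]].
  rewrite -entourage_ballE => -[e /= e0 eE].
  (* Half of [e] turns the weak bound of [unif] into the strict one defining balls. *)
  have [eps0 eps00 close] := unif (e / 2) (divr_gt0 e0 (ltr0Sn R 1)).
  exists eps0 => //= eps; rewrite /ball_/= sub0r normrN => epse eps_gt0.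
  apply: EP => x _; apply: eE => /=; rewrite /ball /= distrC.
  rewrite (le_lt_trans (close _ eps_gt0 _ x))//; last by lra.
  by rewrite -(gtr0_norm eps_gt0).
(* Any tolerance below 1 would do: a zero derivative has speed at distance exactly 1 from 1. *)
have [eps0 eps00 close] := unif (1 / 2) (divr_gt0 ltr01 (ltr0Sn R 1)).
exists eps0 => // eps eps_gt0 epse x; split; first exact: derivable_mollify.
apply/eqP => d0; have := close eps eps_gt0 epse x.
by rewrite d0 eucl_norm0 sub0r normrN normr1; lra.
Qed.
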